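(* Let $G$ be a finitely generated group, and let $H$ be a subgroup of finite index in $G$. Then the following are equivalent: 1. $[G:H] \geq d(G)$. 2. There exists a left transversal $T$ for $H$ in $G$ which contains a generating set $X$ for $G$ of size $|X| = d(G)$.
   Context: For a finitely generated group $G$, $d(G)$ (the rank of $G$) denotes the minimal number of elements in a generating set of $G$. A left transversal for $H$ in $G$ is a set consisting of exactly one representative from each left coset $gH$ of $H$ in $G$. *)

(* Defs.v *)
From mathcomp Require Import all_boot finmap.
From mathcomp Require Import boolp classical_sets cardinality.

Set Implicit Arguments.
Unset Strict Implicit.
Unset Printing Implicit Defensive.

Local Open Scope classical_set_scope.
Local Open Scope card_scope.
Local Open Scope group_scope.

(* Groups are arbitrary, possibly infinite ones ([groupType], not
   [finGroupType]), and their subsets are classical sets. *)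

Definition is_subgroup (G : groupType) (H : set G) : Prop :=
  group_closed [in H].

Definition generated (G : groupType) (X : set G) : set G :=
  smallest (@is_subgroup G) X.

Definition generates (G : groupType) (X : set G) : Prop :=
  generated X = [set: G].

Definition finitely_generated (G : groupType) : Prop :=
  exists2 X : set G, finite_set X & generates X.

Definition has_generating_set_of_size (G : groupType) (n : nat) : Prop :=
  exists2 X : set G, X #= `I_n & generates X.

Lemma fg_size_ex (G : groupType) : finitely_generated G ->
  exists n, `[< has_generating_set_of_size G n >].
Proof. by move=> [X [n Xn] gX]; exists n; apply/asboolP; exists X. Qed.

Definition rank (G : groupType) (Gfg : finitely_generated G) : nat :=
  ex_minn (fg_size_ex Gfg).

Definition lcoset (G : groupType) (g : G) (H : set G) : set G :=
  [set g * h | h in H].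

Definition lcosets (G : groupType) (H : set G) : set (set G) :=
  [set lcoset g H | g in [set: G]].

Definition finite_index (G : groupType) (H : set G) : Prop :=
  finite_set (lcosets H).

(* [fset_set] sends infinite sets to the empty one, so that this is the index
   [G : H] only when [finite_index H] holds. *)
Definition subgroup_index (G : groupType) (H : set G) : nat :=
  #|` fset_set (lcosets H)|%fset.

(* That every element of T represents some left coset is automatic. *)
Definition left_transversal (G : groupType) (H T : set G) : Prop :=
  forall C : set G, lcosets H C -> exists! t, T t /\ C t.

(* Main.v *)
Require Import Defs.
From mathcomp Require Import all_boot finmap.
From mathcomp Require Import boolp classical_sets cardinality.

(* Let G act on the cosets of H. If two members x <> y of a generating set
   lie in the same coset, replace x by h = y^-1 x, which lies in H, and let Y
   consist of the other generators and K be the subgroup generated by Y.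
   Every z = w h, h w or h^-1 w with w in K may replace h without losing
   generation. If no such z lay outside the cosets met by Y, the union of
   these cosets, which contains K and is contained in K H, would be stable
   under Y, h and their inverses, hence would be G. So as long as Y misses a
   coset, one more coset can be reached, keeping the number of generators. *)

Set Implicit Arguments.
Unset Strict Implicit.
Unset Printing Implicit Defensive.

Local Open Scope classical_set_scope.
Local Open Scope card_scope.
Local Open Scope group_scope.

Section Subgroups.
Context {G : groupType}.
Implicit Types H X Y : set G.

Lemma is_subgroupP H : is_subgroup H <->
  [/\ H 1, forall x y, H x -> H y -> H (x * y) & forall x, H x -> H x^-1].
Proof.
split=> [sgH | [H1 HM HV]].
  split=> [|x y Hx Hy|x Hx]; first by have [/set_mem] := sgH.
    by apply/set_mem; apply: (group_closedM sgH); exact/mem_set.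
  by apply/set_mem; apply: (group_closedV sgH); exact/mem_set.
split; first exact/mem_set.
move=> x y /set_mem Hx /set_mem Hy; apply/mem_set.
by apply: HM => //; exact: HV.
Qed.

Lemma generated_subgroup X : is_subgroup (generated X).
Proof.
apply/is_subgroupP; split=> [M [/is_subgroupP[]]//|x y gx gy M|x gx M] [sM XM].
  have [_ MM _] := (is_subgroupP M).1 sM.
  by apply: MM; [apply: gx | apply: gy].
have [_ _ MV] := (is_subgroupP M).1 sM.
by apply: MV; apply: gx.
Qed.

Lemma generates_sub X Y :
  generates X -> X `<=` generated Y -> generates Y.
Proof.
move=> gX XY; rewrite /generates -subTset -gX.
exact: smallest_sub (generated_subgroup Y) XY.
Qed.

End Subgroups.

Section LeftCosets.
Context {G : groupType} {H : set G}.
Hypothesis sgH : is_subgroup H.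
Implicit Types X Y T : set G.

Let H1 : H 1. Proof. by have [] := (is_subgroupP H).1 sgH. Qed.
Let HM x y : H x -> H y -> H (x * y).
Proof. by have [_ + _] := (is_subgroupP H).1 sgH; apply. Qed.
Let HV x : H x -> H x^-1.
Proof. by have [_ _] := (is_subgroupP H).1 sgH; apply. Qed.

Lemma lcoset_eqP a b : lcoset a H = lcoset b H <-> lcoset b H a.
Proof.
split=> [<-|[h Hh <-]]; first by exists 1; rewrite ?mulg1.
apply/seteqP; split=> _ [k Hk <-].
  by exists (h * k); rewrite ?mulgA //; exact: HM.
by exists (h^-1 * k); [apply: HM => //; exact: HV | rewrite mulgA mulgK].
Qed.

Lemma lcoset_id a : lcoset a H a.
Proof. exact/lcoset_eqP. Qed.

Lemma lcosetMr a h : H h -> lcoset (a * h) H = lcoset a H.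
Proof. by move=> Hh; apply/lcoset_eqP; exists h. Qed.

Lemma lcosetMl a b c :
  lcoset b H = lcoset c H -> lcoset (a * b) H = lcoset (a * c) H.
Proof.
by move=> /lcoset_eqP[h Hh <-]; rewrite mulgA; exact: lcosetMr.
Qed.

Lemma coset_exchange Y h g :
    H h -> generates (h |` Y) ->
    (forall y, Y y -> lcoset g H <> lcoset y H) ->
  exists2 z, generates (z |` Y) &
    forall y, Y y -> lcoset z H <> lcoset y H.
Proof.
move=> Hh genhY gY; apply: contrapT => noz.
(* [S] is the union of the cosets met by [Y]; it remains to show that it contains [g]. *)
pose S := [set a | exists2 y, Y y & lcoset a H = lcoset y H].
pose K := generated Y.
have [K1 KM KV] := (is_subgroupP K).1 (generated_subgroup Y).
have YK : Y `<=` K by exact: sub_gen_smallest.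
(* If [h] can be recovered from [z] and [K], then [z] and [Y] generate [G], so [noz] forces [z] into
   a coset met by [Y]. *)
have gen_z z :
    (forall L : set G, is_subgroup L -> K `<=` L -> L z -> L h) -> S z.
  move=> zh; apply: contrapT => Sz; apply: noz; exists z.
    apply: (generates_sub genhY) => x [->|Yx]; last first.
      by apply: sub_gen_smallest; right.
    apply: zh; first exact: generated_subgroup.
      by apply: sub_smallest2r (generated_subgroup _) _ => y; right.
    by apply: sub_gen_smallest; left.
  by move=> y Yy zy; apply: Sz; exists y.
have Seq a b : lcoset a H = lcoset b H -> S b -> S a.
  by move=> ab [y Yy bE]; exists y; rewrite ?ab.
(* The element [w] itself need not recover [h], but [w * h] does, and it lies in the same coset. *)
have KS w : K w -> S w.
  move=> Kw; apply: (Seq _ (w * h)); first by rewrite lcosetMr.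
  apply: gen_z => L /is_subgroupP[_ LM LV] KL Lwh.
  by rewrite -(mulKg w h); apply: LM => //; apply/LV/KL.
have hS w : K w -> S (h * w).
  move=> Kw; apply: gen_z => L /is_subgroupP[_ LM LV] KL Lhw.
  by rewrite -(mulgK w h); apply: LM => //; apply/LV/KL.
have hVS w : K w -> S (h^-1 * w).
  move=> Kw; apply: gen_z => L /is_subgroupP[_ LM LV] KL Lhw.
  rewrite -(mulVKg w h) -(invgK h) -invgM.
  by apply: LM; [exact: KL | exact: LV].
(* The stabilizer of [S] under left multiplication. As [S] may be infinite, [a S] could be a proper
   part of [S]; asking for [a^-1] as well makes [L] a subgroup. *)
pose L := [set a | forall s, S s -> S (a * s) /\ S (a^-1 * s)].
have sgL : is_subgroup L.
  apply/is_subgroupP; split=> [s Ss|a b La Lb s Ss|a La s Ss].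
  - by rewrite invg1 mul1g.
  - rewrite invgM -!mulgA; split.
      by apply: (La _ _).1; apply: (Lb _ Ss).1.
    by apply: (Lb _ _).2; apply: (La _ Ss).2.
  - by rewrite invgK; have [] := La _ Ss.
(* Left multiplication respects left cosets, so [s] may be replaced by a [y] in [Y], hence in
   [K]. *)
have hYL : h |` Y `<=` L.
  move=> a aP s [y Yy sE]; case: aP => [->|Ya]; split.
  - by apply: Seq (lcosetMl _ sE) (hS _ _); exact: YK.
  - by apply: Seq (lcosetMl _ sE) (hVS _ _); exact: YK.
  - by apply: Seq (lcosetMl _ sE) (KS _ _); apply: KM; exact: YK.
  - by apply: Seq (lcosetMl _ sE) (KS _ _); apply: KM; [apply: KV|]; exact: YK.
have Lg : L g by apply: (smallest_sub sgL hYL); rewrite -/(generated _) genhY.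
have [] := Lg 1 (KS 1 K1).
by rewrite mulg1 => -[y Yy gyE] _; exact: gY gyE.
Qed.

(** Induction on [m], each step exchanging one generator to reach a new coset; the case [m = n]
    gives generators in distinct cosets. *)
Lemma generating_set_meeting_cosets n m :
    finite_index H -> (n <= subgroup_index H)%N ->
    has_generating_set_of_size G n -> (m <= n)%N ->
  exists X : {fset G}, [/\ #|` X|%fset = n, generates [set` X] &
    (m <= #|` [fset lcoset x H | x in X]|)%fset%N].
Proof.
move=> fiH ltnG [X0 X0n gX0]; elim: m => [_|m IHm ltmn].
  have finX0 : finite_set X0 by apply/finite_setP; exists n.
  exists (fset_set X0); split=> //; first exact: card_fset_set.
  by rewrite fset_setK.
have [X [Xn gX mX]] := IHm (ltnW ltmn).
have [|leXm] := ltnP m #|` [fset lcoset x H | x in X]%fset|; first by exists X.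
have XmE : #|` [fset lcoset x H | x in X]%fset| = m.
  by apply/eqP; rewrite eqn_leq leXm.
(* Pigeonhole: [n] generators meet only [m < n] cosets. *)
have [x [y [xX yX xy xyH]]] : exists x y,
    [/\ x \in X, y \in X, x <> y & lcoset x H = lcoset y H].
  apply: contrapT => nxy; have /negP := negbT (ltn_eqF ltmn).
  rewrite -XmE -Xn; apply; apply/card_in_imfsetP => x y xX yX xyH.
  by apply: contrapT => xy; apply: nxy; exists x, y.
set Y := (X `\ x)%fset.
have yY : y \in Y by rewrite !inE yX andbT; apply/eqP => yx; exact: xy.
have XE : X = (x |` Y)%fset by rewrite fsetD1K.
(* Dropping [x] loses no coset, since [y] stays. *)
have imXE : [fset lcoset x H | x in X]%fset = [fset lcoset x H | x in Y]%fset.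
  rewrite XE imfsetU1 xyH; apply/fsetUidPr; rewrite fsub1set.
  by apply/imfsetP; exists y.
(* [Y] meets [m] cosets, fewer than the index. *)
have [g gY] : exists g, forall y, y \in Y -> lcoset g H <> lcoset y H.
  apply: contrapT => ng.
  suff : (subgroup_index H <= m)%N by move/(leq_trans ltnG); rewrite leqNgt ltmn.
  rewrite -XmE imXE; apply: fsubset_leq_card; apply/fsubsetP => C.
  rewrite in_fset_set // => /set_mem[g _ <-].
  apply: contrapT => gY; apply: ng; exists g => z zY gz.
  by apply: gY; apply/imfsetP; exists z.
have Hyx : H (y^-1 * x).
  by have /lcoset_eqP[h Hh <-] := xyH; rewrite mulKg.
have gyxY : generates ((y^-1 * x) |` [set` Y]).
  apply: (generates_sub gX) => z; rewrite /= XE.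
  have subL := @sub_gen_smallest _ (@is_subgroup G) ((y^-1 * x) |` [set` Y]).
  case/fset1UP => [->|zY]; last by apply: subL; right.
  have /is_subgroupP[_ LM _] := generated_subgroup ((y^-1 * x) |` [set` Y]).
  have := LM _ _ (subL y (or_intror yY)) (subL _ (or_introl erefl)).
  by rewrite mulVKg.
have [z gzY zY] := coset_exchange Hyx gyxY gY.
have zNY : z \notin Y by apply/negP => /zY.
exists (z |` Y)%fset; split.
- by rewrite cardfsU1 zNY -Xn XE cardfsU1 !inE eqxx.
- by rewrite set_fsetU1.
- rewrite imfsetU1 cardfsU1 -imXE XmE imXE; case: imfsetP => // -[y' y'Y].
  by move=> /zY.
Qed.

Lemma left_transversal_extend X :
    {in X &, injective (fun x => lcoset x H)} ->
  exists2 T, left_transversal H T & X `<=` T.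
Proof.
move=> injX.
(* Keep [X] and add a chosen point of each coset that [X] misses. The default [1] is never returned,
   as cosets are nonempty. *)
pose T := [set t | X t \/ (~ (exists2 x, X x & lcoset x H = lcoset t H)) /\
                          t = xget 1 (lcoset t H)].
exists T; last by move=> x; left.
move=> _ [g _ <-].
have [[x Xx xg]|Ng] := pselect (exists2 x, X x & lcoset x H = lcoset g H).
  exists x; split=> [|t [[Xt|[+ _]] /lcoset_eqP tg]].
  - by split; [left | exact/lcoset_eqP].
  - by apply: injX; rewrite ?xg ?tg //; exact/mem_set.
  - by case; exists x; rewrite ?xg ?tg.
have gxget : lcoset g H (xget 1 (lcoset g H)) by apply: xgetI (lcoset_id g).
have xgetE := (lcoset_eqP _ _).2 gxget.
exists (xget 1 (lcoset g H)); split.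
  by split=> //; right; rewrite xgetE.
move=> t [[Xt|[_ tE]] /lcoset_eqP tg]; first by case: Ng; exists t.
by rewrite -tg.
Qed.

(** Distinct elements of a transversal lie in distinct cosets, so [X] injects into [lcosets H]. *)
Lemma left_transversal_card X T n :
    finite_index H -> left_transversal H T -> X `<=` T -> X #= `I_n ->
  (n <= subgroup_index H)%N.
Proof.
move=> fiH TH XT Xn; apply: leq_card_fset_set => //.
have injX : {in X &, injective (fun x => lcoset x H)}.
  move=> x y /set_mem/XT Tx /set_mem/XT Ty xy.
  have [|t [_ tU]] := TH (lcoset x H); first by exists x.
  rewrite -(tU x) ?(tU y) //; split=> //; last exact: lcoset_id.
  by rewrite xy; exact: lcoset_id.
rewrite -(card_le_eql Xn) -(card_le_eql (inj_card_eq injX)).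
by apply: subset_card_le => _ [x _ <-]; exists x.
Qed.

End LeftCosets.

Theorem theorem3p8 (G : groupType) (Gfg : finitely_generated G) (H : set G)
    (sgH : is_subgroup H) (fiH : finite_index H) :
  (rank Gfg <= subgroup_index H)%N <->
  exists T : set G, left_transversal H T /\
    exists X : set G,
      [/\ (X `<=` T)%classic, generates X & (X #= `I_(rank Gfg))%card].
Proof.
set n := rank Gfg; have gn : has_generating_set_of_size G n.
  by rewrite /n /rank; case: ex_minnP => ? /asboolP.
split=> [len|[T [TH [X [XT _ Xn]]]]]; last first.
  exact: left_transversal_card fiH TH XT Xn.
have [X [Xn gX nX]] := generating_set_meeting_cosets sgH fiH len gn (leqnn n).
(* The [n] elements of [X] meet at least [n] cosets, so no two share one. *)
have [T TH XT] : exists2 T, left_transversal H T & [set` X] `<=` T.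
  apply: left_transversal_extend => // x y; rewrite !mem_setE.
  apply/card_in_imfsetP: x y.
  by rewrite eqn_leq Xn nX andbT -Xn leq_imfset_card.
exists T; split=> //; exists [set` X]; split=> //; exact/card_eq_fsetP.
Qed.
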